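(* Let $k\ge 2$ be a fixed integer. Suppose $G$ is a $(\mathcal{C}^{\mathrm{even}}_{2k}\cup\mathcal{C}_k)$-free graph on $n$ vertices with average degree $d\sim n^{1/k}$ (as $n\to\infty$). Then $e_G(S,T)=\frac{d}{n}|S||T|+o(n^{1+1/k})$ for any $S,T\subseteq V(G)$.
   Context: Graphs are finite and simple. $\mathcal{C}^{\mathrm{even}}_{2k}=\{C_4,C_6,\dots,C_{2k}\}$ and $\mathcal{C}_k=\{C_3,\dots,C_k\}$; a graph is $\mathcal{F}$-free if it contains no subgraph isomorphic to a member of $\mathcal{F}$. For $S,T\subseteq V(G)$, not necessarily disjoint, $e_G(S,T)$ is the number of ordered pairs $(s,t)$ with $s\in S$, $t\in T$ and $st\in E(G)$. Asymptotic notation refers to $n\to\infty$ with $k$ fixed; $d\sim n^{1/k}$ means $d/n^{1/k}\to 1$, and the $o(n^{1+1/k})$ term is uniform over all $S,T$. *)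

(* Defs.v *)
From mathcomp Require Import all_boot all_order all_algebra.
From mathcomp Require Import all_classical all_reals all_analysis.

Set Implicit Arguments.
Unset Strict Implicit.
Unset Printing Implicit Defensive.

Import Order.TTheory GRing.Theory Num.Theory.
Import numFieldNormedType.Exports.

Local Open Scope classical_set_scope.
Local Open Scope ring_scope.

Record sgraph := SGraph {
  vertex :> finType;
  adj : rel vertex;
  adj_sym : symmetric adj;
  adj_irr : irreflexive adj }.

(* Not necessarily induced: adjacency only has to be preserved. *)
Definition contains (G H : sgraph) : Prop :=
  exists2 f : H -> G, injective f & forall x y, adj x y -> adj (f x) (f y).

(* F is a plain predicate because `set sgraph` is universe inconsistent. *)
Definition family_free (F : sgraph -> Prop) (G : sgraph) : Prop :=
  forall H, F H -> ~ contains G H.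

(* The conjunct i != j matters only for the degenerate length l = 1; it makes
   the relation irreflexive for every l. *)
Definition cycle_adj (l : nat) : rel 'I_l :=
  fun i j => (i != j) && ((j == ordS i) || (i == ordS j)).

Lemma cycle_adj_sym l : symmetric (@cycle_adj l).
Proof. by move=> i j; rewrite /cycle_adj eq_sym orbC. Qed.

Lemma cycle_adj_irr l : irreflexive (@cycle_adj l).
Proof. by move=> i; rewrite /cycle_adj eqxx. Qed.

Definition cycle_graph (l : nat) : sgraph :=
  SGraph (@cycle_adj_sym l) (@cycle_adj_irr l).

(* {C_4, C_6, ..., C_2k} *)
Definition even_cycles (k : nat) (H : sgraph) : Prop :=
  exists2 l : nat, (2 <= l <= k)%N & H = cycle_graph l.*2.

(* {C_3, C_4, ..., C_k}, empty for k = 2 *)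
Definition short_cycles (k : nat) (H : sgraph) : Prop :=
  exists2 l : nat, (3 <= l <= k)%N & H = cycle_graph l.

Definition degree (G : sgraph) (x : G) : nat := #|[set y | adj x y]%SET|.

Definition avg_degree (R : realType) (G : sgraph) : R :=
  (\sum_(x : G) degree x)%N%:R / #|G|%:R.

(* Ordered pairs, so an edge with both ends in S :&: T counts twice. *)
Definition edges_between (G : sgraph) (S T : {set G}) : nat :=
  #|[set p : G * G | [&& p.1 \in S, p.2 \in T & adj p.1 p.2]]%SET|.

(* Main.v *)
Require Import Defs.
From mathcomp Require Import all_boot all_order all_algebra.
From mathcomp Require Import all_classical all_reals all_analysis.
From mathcomp Require Import fintype finset zify ring lra.

Set Implicit Arguments.
Unset Strict Implicit.
Unset Printing Implicit Defensive.

Import Order.TTheory GRing.Theory Num.Theory.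
Import numFieldNormedType.Exports.

(* The forbidden cycles leave at most one simple path of length k between two
   given vertices. Passing to an induced subgraph that loses few edges, all
   positive degrees are at least eps n^(1/k); since distinct k-paths from a
   vertex have distinct endpoints, the degrees are then O(n^(1/k)), so that
   only O(n^(1-1/k)) of the k-walks from a vertex are not simple paths. Hence
   A^k = N + B, with N a 0/1 matrix and B of small row sums. Log-convexity of
   j |-> |A^j 1|^2 gives |A^k 1|^2 >= (1 - o(1)) n^3, which forces all but o(n^2)
   entries of N to be 1. On vectors orthogonal to 1 this yields |A^k f| = o(n)|f|,
   and log-convexity of j |-> |A^j f|^2 turns it into |A f| = o(n^(1/k))|f|,
   from which the expander mixing argument concludes. *)

(** * Uniqueness of short simple paths *)

Lemma ucycle_contains (G : sgraph) (s : seq G) :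
  (2 < size s)%N -> cycle (@adj G) s -> uniq s -> contains G (cycle_graph (size s)).
Proof.
case: s => [//|y s] _ cyc us.
have step i : (i < size (y :: s))%N ->
  adj (nth y (y :: s) i) (nth y (y :: s) (i.+1 %% size (y :: s))).
  move=> lti; have := next_cycle cyc (mem_nth y lti).
  rewrite next_nth (mem_nth y lti) (index_uniq _ lti us).
  have [lt_is|ge_is] := ltnP i (size s); first by rewrite modn_small.
  rewrite (nth_default _ ge_is).
  have -> : i.+1 = size (y :: s) by apply/eqP; rewrite eqn_leq lti ltnS.
  by rewrite modnn.
exists (fun i : 'I_(size (y :: s)) => nth y (y :: s) i) => [i j /eqP|i j].
  by rewrite nth_uniq ?ltn_ord // => /eqP/val_inj.
case/andP=> _ /orP[] /eqP ->; first exact: step.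
by rewrite adj_sym; apply: step.
Qed.

(** [p] and [q] list inner vertices only, so the closed sequence runs out along [p] through [y] and
    back along [q] reversed. *)
Lemma internally_disjoint_cycle (V : eqType) (e : rel V) (x y : V) (p q : seq V) :
  symmetric e -> path e x (rcons p y) -> path e x (rcons q y) ->
  uniq (x :: rcons p y) -> uniq (x :: rcons q y) -> ~~ has [in p] q ->
  cycle e (x :: rcons p y ++ rev q) && uniq (x :: rcons p y ++ rev q).
Proof.
move=> e_sym pp pq up uq dis; apply/andP; split.
  rewrite /= -cats1 -catA cats1 cat_path pp last_rcons.
  have := rev_path e x (rcons q y); rewrite last_rcons belast_rcons rev_cons => ->.
  by rewrite (eq_path (e' := e)).
rewrite -cat_cons cat_uniq up rev_uniq.
move: uq; rewrite /= mem_rcons inE rcons_uniq => /and3P[/norP[_ xq] yq ->].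
rewrite andbT has_rev; apply/hasPn => z zq.
rewrite /= inE mem_rcons inE !negb_or; apply/and3P; split.
- by apply: contraNneq xq => <-.
- by apply: contraNneq yq => <-.
- by move/hasPn: dis => /(_ z zq).
Qed.

Section UniquePaths.
Variables (k : nat) (G : sgraph).
Hypothesis G_free :
  family_free (fun H => even_cycles k H \/ short_cycles k H) G.

(** Tested on the total length of two paths, since halves cut at a common vertex may differ in
    length. Lengths below 3 qualify too; cycles are separately required to have more than two
    vertices. *)
Let forbidden l := (l <= k)%N || (~~ odd l && (l <= k.*2)%N).

Lemma no_forbidden_cycle (s : seq G) :
  (2 < size s)%N -> forbidden (size s) -> cycle (@adj G) s -> ~~ uniq s.
Proof.
move=> s3 fs cyc; apply/negP => us; move: (ucycle_contains s3 cyc us).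
apply: G_free; case/orP: fs => [sk|/andP[ev sk]].
  by right; exists (size s); rewrite ?s3.
left; exists (size s)./2; first by apply/andP; split; lia.
by rewrite even_halfK.
Qed.

(* At a common inner vertex both paths split. If the left halves have odd total
   length then so do the right halves; one of these totals is at most [k],
   while halves of odd total length cannot coincide. *)
Lemma simple_paths_eq (x : G) (p q : seq G) :
  forbidden (size p + size q) ->
  path (@adj G) x p -> path (@adj G) x q -> uniq (x :: p) -> uniq (x :: q) ->
  last x p = last x q -> p = q.
Proof.
have [l] := ubnP (size p + size q); elim: l x p q => // l IHl x p q lel fpq.
case/lastP: p lel fpq => [|p y] lel fpq.
  move=> _ _ _; case: q lel fpq => //= a q _ _ /andP[xaq _] xl.
  by move: xaq; rewrite xl mem_last.
case/lastP: q lel fpq => [|q y'] lel fpq.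
  move=> _ _ /= /andP[xaq _] _ xl.
  by move: xaq; rewrite -xl last_rcons mem_rcons mem_head.
rewrite !last_rcons => pp pq up uq yy'; subst y'.
have [/hasP[z zq zp]|dis] := boolP (has [in p] q); last first.
  case/andP: (internally_disjoint_cycle (@adj_sym G) pp pq up uq dis) => cyc us.
  have [s3|] := ltnP 2 (size (x :: rcons p y ++ rev q)).
    have := no_forbidden_cycle s3 _ cyc; rewrite us => /(_ _)/negP [] //.
    move: fpq; rewrite /= !size_cat !size_rcons size_rev.
    by rewrite addSn addnS.
  (* With only two vertices, [p] and [q] are both empty. *)
  rewrite /= size_cat size_rcons size_rev.
  by case: p {pp lel fpq up dis cyc us} => //; case: q {pq uq}.
move: zp zq lel fpq pp pq up uq.
case/splitPr=> p1 p2; case/splitPr=> q1 q2.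
rewrite !rcons_cat !rcons_cons -!cat_rcons => lel fpq.
rewrite !cat_path -!(cat_cons x) !cat_uniq !last_rcons.
move=> /andP[pp1 pp2] /andP[pq1 pq2] /and3P[up1 dp up2] /and3P[uq1 dq uq2].
have right s1 s2 : ~~ has [in x :: rcons s1 z] s2 -> uniq s2 -> uniq (z :: s2).
  move=> /hasPn ds us /=; rewrite us andbT; apply/negP => /ds.
  by rewrite inE mem_rcons mem_head orbT.
move: lel fpq; rewrite !size_cat !size_rcons => lel fpq.
have L : forbidden (size p1 + size q1 + 2) -> rcons p1 z = rcons q1 z.
  move=> fL; apply: (IHl x) => //; rewrite ?size_rcons ?last_rcons //.
  - by clear -lel; lia.
  - by move: fL; rewrite !addSn !addnS addn0.
have Rr : forbidden (size p2 + size q2 + 2) -> rcons p2 y = rcons q2 y.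
  move=> fL; apply: (IHl z) => //; rewrite ?size_rcons ?last_rcons //.
  - by clear -lel; lia.
  - by move: fL; rewrite !addSn !addnS addn0.
  - exact: right dp up2.
  - exact: right dq uq2.
have Ls : forbidden (size p1 + size q1 + 2) -> ~~ odd (size p1 + size q1 + 2).
  move=> /L /(congr1 size); rewrite !size_rcons => -[->].
  by rewrite addnn oddD odd_double.
have Rs : forbidden (size p2 + size q2 + 2) -> ~~ odd (size p2 + size q2 + 2).
  move=> /Rr /(congr1 size); rewrite !size_rcons => -[->].
  by rewrite addnn oddD odd_double.
have {}fpq : forbidden ((size p1 + size q1 + 2) + (size p2 + size q2 + 2)).
  congr (is_true (forbidden _)): fpq.
  by move: (size p1) (size p2) (size q1) (size q2) => a b c d; clear; lia.
suff /andP[fL fR] : forbidden (size p1 + size q1 + 2) &&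
    forbidden (size p2 + size q2 + 2) by rewrite L ?Rr.
(* If exactly one total is odd, the whole is odd, hence at most [k], and the odd total contradicts
   [Ls] or [Rs]. If both are even, each is at most [k.*2]. *)
move: fpq Ls Rs; rewrite /forbidden oddD; clear.
set a := (_ + _ + 2)%N; set b := (_ + _ + 2)%N.
by case: (odd a); case: (odd b) => /=; lia.
Qed.

End UniquePaths.

(** * Endpoints of simple paths *)

Section PathEnds.
Variables (V : finType) (e : rel V).

Definition nbrs (x : V) : {set V} := [set y | e x y].

(** For [j = k], read as a 0/1 matrix, this is [N] in [A^k = N + B], where [walks k] is [A^k]. *)
Definition ends (j : nat) (x : V) : {set V} :=
  [set y | [exists p : j.-tuple V, [&& path e x p, uniq (x :: p) & last x p == y]]].

Fixpoint walks (j : nat) (x y : V) : nat :=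
  if j is j'.+1 then \sum_(z | e z y) walks j' x z else (x == y).

Lemma endsP j x y :
  reflect (exists p, [/\ size p = j, path e x p, uniq (x :: p) & last x p = y])
    (y \in ends j x).
Proof.
rewrite inE; apply: (iffP existsP) => [[p /and3P[pp up /eqP lp]]|[p [sp pp up lp]]].
  by exists p; rewrite size_tuple.
by move/eqP: sp => sp; exists (Tuple sp); apply/and3P; split=> //; apply/eqP.
Qed.

Lemma ends0 x : ends 0 x = [set x].
Proof.
apply/setP => y; rewrite in_set1; apply/endsP/eqP => [[p [/size0nil-> _ _ <-]]//|->].
by exists [::].
Qed.

Lemma sum_walksS j x :
  \sum_y walks j.+1 x y = \sum_z walks j x z * #|nbrs z|.
Proof.
rewrite /= (exchange_big_dep xpredT) //=; apply: eq_bigr => z _.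
rewrite mulnC -sum_nat_const; apply: eq_bigl => y;
  by rewrite inE.
Qed.

(** A simple path without its last vertex is again simple. The inequality makes [B] entrywise
    nonnegative. *)
Lemma ends_le_walks j x y : (y \in ends j x) <= walks j x y.
Proof.
elim: j y => [|j IHj] y; first by rewrite ends0 in_set1 eq_sym.
have [/endsP[p []]|//] := boolP (y \in ends j.+1 x).
case/lastP: p => [//|p y']; rewrite size_rcons rcons_path last_rcons => -[sp].
case/andP=> pp ey' /= /andP[xp up] yy'; subst y'.
rewrite (bigD1 (last x p)) //=; apply: leq_trans (leq_addr _ _).
have p_end : last x p \in ends j x.
  apply/endsP; exists p; split => //=.
  move: xp up; rewrite mem_rcons inE rcons_uniq.
  by case/norP=> _ -> /andP[].
by have := IHj (last x p); rewrite p_end.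
Qed.

Lemma sum_walks_le D j x :
  (forall z, #|nbrs z| <= D) -> \sum_y walks j x y <= D ^ j.
Proof.
move=> degD; elim: j => [|j IHj].
  rewrite (bigD1 x) //= eqxx big1 // => y /negPf.
  by rewrite eq_sym => ->.
rewrite sum_walksS expnSr; apply: leq_trans (leq_mul IHj (leqnn D)).
by rewrite big_distrl; apply: leq_sum => z _; rewrite leq_mul2l degD orbT.
Qed.

Lemma card_sum_mem (A : {set V}) : #|A| = \sum_y (y \in A).
Proof. by rewrite -sum1_card big_mkcond; apply: eq_bigr => y _; case: ifP. Qed.

Hypothesis e_sym : symmetric e.

(** By reversal of paths; with [walks_sym] it turns row bounds for [B] into column bounds. *)
Lemma ends_sym j x y : (y \in ends j x) = (x \in ends j y).
Proof.
wlog suff H : x y / y \in ends j x -> x \in ends j y.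
  by apply/idP/idP; apply: H.
case/endsP=> p [sp pp up lp]; apply/endsP; exists (rev (belast x p)).
have rcE : rev (x :: p) = y :: rev (belast x p) by rewrite lastI rev_rcons lp.
split; first by rewrite size_rev size_belast.
- by rewrite -lp rev_path (eq_path (e' := e)).
- by rewrite -rcE rev_uniq.
- case: p sp pp up lp rcE => [|a p] //= *.
  by rewrite rev_cons last_rcons.
Qed.

Variable k : nat.

(** Stated for a relation, so that it applies to induced subgraphs on the same vertex type. Equal
    lengths make the total even and at most [k.*2]. *)
Definition path_unique : Prop := forall x p q, size p <= k -> size q = size p ->
  path e x p -> path e x q -> uniq (x :: p) -> uniq (x :: q) ->
  last x p = last x q -> p = q.

Hypothesis e_uniq : path_unique.

(* All but at most [j + 1] of the neighbours of [z] extend the path to [z],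
   and by uniqueness distinct extensions have distinct endpoints. *)
Lemma ends_growth j x : j < k ->
  \sum_(z in ends j x) #|nbrs z| <= #|ends j.+1 x| + j.+1 * #|ends j x|.
Proof.
move=> ltjk.
have /fin_all_exists[pth pthP] z : exists p, z \in ends j x ->
    [/\ size p = j, path e x p, uniq (x :: p) & last x p = z].
  by case: (endsP j x z) => [[p ?]|_]; [exists p|exists [::]].
pose Y z := [set y in nbrs z | y \notin x :: pth z].
have degY z : z \in ends j x -> #|nbrs z| <= #|Y z| + j.+1.
  move=> /pthP[sz _ _ _]; rewrite -(cardsID [set y | y \in x :: pth z]) addnC.
  apply: leq_add.
    by apply: subset_leq_card; apply/subsetP => y; rewrite !inE andbC.
  rewrite -sz -[(size _).+1]/(size (x :: pth z)).
  apply: leq_trans (card_size _); apply: subset_leq_card.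
  by apply/subsetP => y; rewrite !inE => /andP[].
apply: (@leq_trans (\sum_(z in ends j x) (#|Y z| + j.+1))).
  exact: leq_sum.
rewrite big_split sum_nat_const mulnC leq_add2r.
under eq_bigr do rewrite -sum1_card.
rewrite (exchange_big_dep xpredT) //= card_sum_mem.
apply: leq_sum => y _; rewrite sum1_card.
have ext z : z \in ends j x -> y \in Y z ->
  [/\ size (rcons (pth z) y) = j.+1, path e x (rcons (pth z) y),
      uniq (x :: rcons (pth z) y) & last x (rcons (pth z) y) = y].
  move=> /pthP[sz pz uz lz]; rewrite !inE negb_or => /and3P[ey yx yz].
  rewrite size_rcons sz rcons_path pz lz last_rcons; split => //.
  by rewrite -rcons_cons rcons_uniq uz inE negb_or yx yz.
have [yE|] := boolP (y \in ends j.+1 x).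
  apply/card_le1_eqP => z z' /andP[zE zY] /andP[zE' zY'].
  have [s1 p1 u1 l1] := ext z zE zY; have [s2 p2 u2 l2] := ext z' zE' zY'.
  have : rcons (pth z) y = rcons (pth z') y.
    by apply: (e_uniq (x := x)); rewrite ?s1 ?s2 ?l1 ?l2.
  case/rcons_inj=> pzz'.
  by have [_ _ _ <-] := pthP z zE; have [_ _ _ <-] := pthP z' zE'; rewrite pzz'.
move=> yE; rewrite leqn0; apply/pred0P => z; apply/negP => /andP[zE zY].
by case/endsP: yE; exists (rcons (pth z) y); apply: ext.
Qed.

(** The excess of walks over endpoints is multiplied by at most [D] at each step and gains at most
    [j.+1 * D ^ j]; these gains are absorbed by [j ^ 2]. The extra factor [D] avoids the exponent
    [j - 1]. *)
Lemma sum_walks_ends D j x : (forall z, #|nbrs z| <= D) -> j <= k ->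
  (\sum_y walks j x y) * D <= #|ends j x| * D + j ^ 2 * D ^ j.
Proof.
move=> degD; elim: j => [|j IHj] lejk.
  rewrite ends0 cards1; apply: leq_trans (leq_addr _ _).
  exact: leq_mul (sum_walks_le 0 x degD) (leqnn D).
have ends_le : #|ends j x| <= D ^ j.
  apply: leq_trans (sum_walks_le j x degD); rewrite card_sum_mem.
  by apply: leq_sum => y _; apply: ends_le_walks.
(* Pointwise, the product of [walks j x z - (z \in ends j x)] and [D - #|nbrs z|] is nonnegative. *)
have step : \sum_y walks j.+1 x y + #|ends j x| * D <=
    \sum_(z in ends j x) #|nbrs z| + (\sum_y walks j x y) * D.
  rewrite sum_walksS (card_sum_mem (ends j x)) !big_distrl.
  rewrite [X in _ <= X + _]big_mkcond -!big_split /=.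
  apply: leq_sum => z _; have := ends_le_walks j x z.
  by case: (z \in _); have := degD z; nia.
have growth := ends_growth x lejk; move: (IHj (ltnW lejk)) => {}IHj.
have cj : j.+1 * #|ends j x| <= j.+1 * D ^ j by rewrite leq_mul2l ends_le orbT.
have sq : j ^ 2 * D ^ j + j.+1 * D ^ j <= j.+1 ^ 2 * D ^ j.
  by rewrite -mulnDl leq_mul2r; apply/orP; right; rewrite -!mulnn; nia.
have : \sum_y walks j.+1 x y <= #|ends j.+1 x| + j.+1 ^ 2 * D ^ j by lia.
by move/leq_mul => /(_ D D (leqnn D)); rewrite mulnDl (expnSr D) mulnA.
Qed.

(* A simple path has at least [c - k] extensions at each step after the first,
   and the paths of length [k] from [x] have distinct endpoints. *)
Lemma degree_bound c x : 0 < k -> (forall z y, e z y -> c <= #|nbrs z|) ->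
  (#|nbrs x|.-1) * (c - k) ^ k.-1 <= #|V|.
Proof.
move=> k_gt0 minc.
suff H j : j < k -> (#|nbrs x|.-1) * (c - k) ^ j <= #|ends j.+1 x|.
  apply: leq_trans (H _ _) (max_card _); by rewrite prednK.
elim: j => [|j IHj] ltjk.
  (* The predecessor in the statement is the loss of 1 in [ends_growth] at index 0. *)
  have := ends_growth x ltjk; rewrite ends0 big_set1 cards1; lia.
have growth := ends_growth x ltjk.
have : c * #|ends j.+1 x| <= \sum_(z in ends j.+1 x) #|nbrs z|.
  rewrite mulnC -sum_nat_const; apply: leq_sum => z /endsP[p []].
  (* The last edge of the path shows that its end is not isolated, so [minc] applies to it. *)
  case/lastP: p => [//|p z'] _; rewrite rcons_path last_rcons => /andP[_ ez] _ <-.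
  by apply: (minc _ (last x p)); rewrite e_sym.
move: (IHj (ltnW ltjk)) growth; rewrite expnS.
have : c - k <= c - j.+2 by lia.
nia.
Qed.

End PathEnds.

(** * Induced subgraphs with large positive degrees *)

Section DenseSubgraph.
Variables (V : finType) (e : rel V).
Hypotheses (e_sym : symmetric e) (e_irr : irreflexive e).

(** The vertex type stays [V]: vertices outside [U] become isolated and the number of vertices does
    not change. *)
Definition induced_rel (U : {set V}) : rel V :=
  fun x y => [&& x \in U, y \in U & e x y].

Definition arcs (r : rel V) (S T : {set V}) : nat :=
  \sum_(x in S) \sum_(y in T) r x y.

(* [U] maximises the number of arcs inside [U] plus [2 c] for each vertex
   outside [U]. *)
Lemma dense_subgraph (c : nat) : exists U : {set V},
  (forall z y, induced_rel U z y -> c <= #|nbrs (induced_rel U) z|) /\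
  arcs e setT setT <= arcs (induced_rel U) setT setT + 2 * c * #|V|.
Proof.
pose phi (U : {set V}) := arcs (induced_rel U) setT setT + 2 * c * #|~: U|.
have [U _ Umax] := arg_maxnP phi (isT : predT setT).
exists U; split; last first.
  have := Umax setT isT; rewrite /phi setCT cards0 muln0 addn0.
  have -> : arcs (induced_rel setT) setT setT = arcs e setT setT.
    by apply: eq_bigr => x _; apply: eq_bigr => y _; rewrite /induced_rel !inE.
  move/leq_trans; apply; rewrite leq_add2l leq_mul2l max_card orbT //.
move=> z y /and3P[zU _ _]; have := Umax (U :\ z) isT; rewrite /phi.
have -> : ~: (U :\ z) = z |: ~: U.
  by apply/setP => t; rewrite !inE negb_and negbK.
rewrite cardsU1 inE zU mulnDr muln1.
(* Deleting [z] costs twice its degree and earns [2 * c], so maximality of [U] bounds the degree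
   below by [c]. *)
suff -> : arcs (induced_rel U) setT setT =
    arcs (induced_rel (U :\ z)) setT setT + 2 * #|nbrs (induced_rel U) z|.
  by lia.
have nbrsE : #|nbrs (induced_rel U) z| = \sum_t induced_rel U z t.
  by rewrite card_sum_mem; apply: eq_bigr => t _; rewrite inE.
have split_term a b : induced_rel U a b =
    induced_rel (U :\ z) a b + (a == z) * induced_rel U z b + (b == z) * induced_rel U z a
    :> nat.
  rewrite /induced_rel !inE; have [->|az] := eqVneq a z; have [->|bz] := eqVneq b z;
    rewrite /= ?e_irr ?zU ?andbF ?andbT ?mul0n ?mul1n ?addn0 ?add0n //.
  by rewrite e_sym.
rewrite /arcs; under eq_bigl do rewrite inE.
under [in RHS]eq_bigl do rewrite inE.
under eq_bigr => a _ do under eq_bigl do rewrite inE.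
under [in RHS]eq_bigr => a _ do under eq_bigl do rewrite inE.
under eq_bigr => a _ do (under eq_bigr => b _ do rewrite split_term).
under eq_bigr do rewrite !big_split.
rewrite !big_split /= -addnA; congr (_ + _); rewrite mul2n -addnn nbrsE.
congr (_ + _).
  rewrite (bigD1 z) //= [X in _ + X]big1 => [|a /negPf az].
    by rewrite addn0; apply: eq_bigr => b _; rewrite eqxx mul1n.
  by rewrite big1 // => b _; rewrite az.
apply: eq_bigr => a _; rewrite (bigD1 z) //= eqxx mul1n big1 ?addn0 //.
by move=> b /negPf->.
Qed.

End DenseSubgraph.

Local Open Scope ring_scope.

(** * The adjacency operator *)

Section Inequalities.
Variable R : realFieldType.

(** Lagrange's identity: twice the difference of the sides is the sum of
    [c i * c j * (a i * b j - a j * b i) ^+ 2] over all pairs. *)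
Lemma weighted_cauchy_schwarz (I : finType) (c a b : I -> R) :
  (forall i, 0 <= c i) ->
  (\sum_i c i * (a i * b i)) ^+ 2 <=
    (\sum_i c i * a i ^+ 2) * (\sum_i c i * b i ^+ 2).
Proof.
move=> c0; rewrite -subr_ge0 -(pmulr_rge0 _ (ltr0Sn R 1)).
set A := \sum_i c i * a i ^+ 2; set B := \sum_i c i * b i ^+ 2.
set C := \sum_i _; have -> : 2 * (A * B - C ^+ 2) = A * B + B * A - 2 * (C * C).
  by ring.
rewrite !big_distrlr -big_split /= mulr_sumr -sumrB.
apply: sumr_ge0 => i _; rewrite mulr_sumr -big_split -sumrB.
apply: sumr_ge0 => j _ /=.
have -> : c i * a i ^+ 2 * (c j * b j ^+ 2) + c i * b i ^+ 2 * (c j * a j ^+ 2) -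
  2 * (c i * (a i * b i) * (c j * (a j * b j))) =
  c i * c j * (a i * b j - a j * b i) ^+ 2 by ring.
by apply: mulr_ge0; [apply: mulr_ge0 | apply: sqr_ge0].
Qed.

Lemma cauchy_schwarz (I : finType) (a b : I -> R) :
  (\sum_i a i * b i) ^+ 2 <= (\sum_i a i ^+ 2) * (\sum_i b i ^+ 2).
Proof.
have := @weighted_cauchy_schwarz I (fun=> 1) a b (fun=> ler01).
have one (F : I -> R) : \sum_i 1 * F i = \sum_i F i.
  by under eq_bigr do rewrite mul1r.
by rewrite !one.
Qed.

(** The ratios [a j.+1 / a j] are nondecreasing, hence at least [a 1 / a 0]. Clearing denominators
    in [ratio] allows zero terms. *)
Lemma log_convex_power (a : nat -> R) (k : nat) : (forall j, 0 <= a j) ->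
  (forall j, a j.+1 ^+ 2 <= a j * a j.+2) -> a 1%N ^+ k.+1 <= a 0%N ^+ k * a k.+1.
Proof.
move=> a0 aLC.
have ratio j : a 1%N * a j <= a 0%N * a j.+1.
  elim: j => [|j IHj]; first by rewrite mulrC.
  have := a0 j; rewrite le_eqVlt => /orP[/eqP aj|aj].
    have := aLC j; rewrite -aj mul0r => aj1.
    have /eqP-> : a j.+1 == 0 by rewrite -sqrf_eq0 eq_le aj1 sqr_ge0.
    by rewrite mulr0 mulr_ge0.
  rewrite -(ler_pM2l aj); have := aLC j; have := a0 0%N; have := a0 j.+1.
  nra.
elim: k => [|k IHk]; first by rewrite mul1r.
rewrite exprS; apply: le_trans (ler_wpM2l (a0 1%N) IHk) _.
by rewrite mulrCA (exprSr (a 0%N)) -mulrA ler_wpM2l ?exprn_ge0.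
Qed.

End Inequalities.

Section AdjacencyOperator.
Variables (R : realFieldType) (V : finType) (e : rel V).
Hypothesis e_sym : symmetric e.

Definition adjacency (f : V -> R) (x : V) : R := \sum_(y | e x y) f y.

Definition sqnorm (f : V -> R) : R := \sum_x f x ^+ 2.

Lemma sqnorm_ge0 f : 0 <= sqnorm f.
Proof. by apply: sumr_ge0 => x _; apply: sqr_ge0. Qed.

Lemma adjacency_selfadjoint (f g : V -> R) :
  \sum_x f x * adjacency g x = \sum_x adjacency f x * g x.
Proof.
under eq_bigr do rewrite mulr_sumr.
rewrite (exchange_big_dep xpredT) //=; apply: eq_bigr => y _.
by rewrite mulr_suml; apply: eq_bigl => x; rewrite e_sym.
Qed.

(** By self-adjointness the squared norm of [A^(j+1) f] is the inner product of [A^j f] and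
    [A^(j+2) f], so Cauchy-Schwarz gives log-convexity. *)
Lemma sqnorm_iter_adjacency (f : V -> R) (k : nat) :
  sqnorm (adjacency f) ^+ k.+1 <=
    sqnorm f ^+ k * sqnorm (iter k.+1 adjacency f).
Proof.
apply: (@log_convex_power R (fun j => sqnorm (iter j adjacency f))) => j.
  exact: sqnorm_ge0.
suff -> : sqnorm (iter j.+1 adjacency f) =
    \sum_x iter j adjacency f x * iter j.+2 adjacency f x.
  exact: cauchy_schwarz.
by rewrite [RHS]adjacency_selfadjoint; apply: eq_bigr => x _; rewrite expr2.
Qed.

Lemma iter_adjacency_walks (f : V -> R) (j : nat) (x : V) :
  iter j adjacency f x = \sum_y (walks e j x y)%:R * f y.
Proof.
elim: j f => [|j IHj] f.
  rewrite (bigD1 x) //= eqxx mul1r big1 ?addr0 // => y /negPf.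
  by rewrite eq_sym => ->; rewrite mul0r.
rewrite iterSr IHj /=.
under eq_bigr do rewrite mulr_sumr.
rewrite (exchange_big_dep xpredT) //=; apply: eq_bigr => y _.
by rewrite natr_sum mulr_suml.
Qed.

Lemma walksSl j x y : walks e j.+1 x y = (\sum_(z | e x z) walks e j z y)%N.
Proof.
elim: j y => [|j IHj] y.
  rewrite /= big_mkcond (bigD1 x) //= eqxx big1 => [|z /negPf zx]; last first.
    by rewrite eq_sym zx if_same.
  rewrite addn0 big_mkcond (bigD1 y) //= eqxx big1 ?addn0 // => z /negPf ->.
  by rewrite if_same.
rewrite [LHS]/=; under eq_bigr do rewrite -/(walks e j.+1 _ _) IHj.
by rewrite exchange_big.
Qed.

Lemma walks_sym j x y : walks e j x y = walks e j y x.
Proof.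
elim: j x y => [|j IHj] x y; first by rewrite /= eq_sym.
by rewrite walksSl; apply: eq_big => [z|z _]; [rewrite e_sym | rewrite IHj].
Qed.

(** * Consequences of most walks being simple paths *)

Section WalkCount.
Variables (k : nat) (b : R).
Hypothesis walks_ends :
  forall x, (\sum_y walks e k x y)%:R <= #|ends e k x|%:R + b.

Let c : R := \sum_x #|ends e k x|%:R.
Let n : R := #|V|%:R.

(** Write [A^k = J - M + B] with [J] the all-ones matrix, which kills [f], and [M = J - N], which
    has [n ^+ 2 - c] ones. The factor 2 comes from squaring a difference. *)
Lemma sqnorm_iter_adjacency_sum0 (f : V -> R) : \sum_x f x = 0 ->
  sqnorm (iter k adjacency f) <= 2 * (n ^+ 2 - c + b ^+ 2) * sqnorm f.
Proof.
move=> f0.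
pose N x y : R := (y \in ends e k x)%:R.
pose B x y : R := (walks e k x y)%:R - N x y.
have B0 x y : 0 <= B x y by rewrite subr_ge0 ler_nat ends_le_walks.
have M0 x y : 0 <= 1 - N x y by rewrite subr_ge0 lern1 leq_b1.
have M1 x y : 1 - N x y <= 1 by rewrite gerBl ler0n.
have Nsum x : \sum_y N x y = #|ends e k x|%:R by rewrite card_sum_mem natr_sum.
have Brow x : \sum_y B x y <= b.
  by rewrite sumrB Nsum -natr_sum lerBlDl walks_ends.
have Bcol y : \sum_x B x y <= b.
  rewrite (eq_bigr (B y)) // => x _.
  by rewrite /B /N walks_sym ends_sym.
(* The factors [1 *] give the sums the shape of [weighted_cauchy_schwarz]. *)
have AB x : iter k adjacency f x =
    \sum_y B x y * (1 * f y) - \sum_y (1 - N x y) * (1 * f y).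
  transitivity (iter k adjacency f x - \sum_x f x); first by rewrite f0 subr0.
  rewrite iter_adjacency_walks -!sumrB.
  by apply: eq_bigr => y _; rewrite /B; ring.
(* Schur's test: row and column sums of [B] are at most [b]. *)
have Bf : \sum_x (\sum_y B x y * (1 * f y)) ^+ 2 <= b ^+ 2 * sqnorm f.
  apply: (@le_trans _ _ (\sum_x b * \sum_y B x y * f y ^+ 2)).
    apply: ler_sum => x _.
    apply: le_trans (weighted_cauchy_schwarz _ _ (B0 x)) _.
    apply: ler_wpM2r; first by apply: sumr_ge0 => y _; rewrite mulr_ge0 ?sqr_ge0.
    by under eq_bigr do rewrite expr1n mulr1; apply: Brow.
  have [x0 _|V0] := pickP (mem V); last first.
    by rewrite big_pred0 // mulr_ge0 ?sqr_ge0 ?sqnorm_ge0.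
  have b0 : 0 <= b by apply: le_trans (Brow x0); apply: sumr_ge0.
  rewrite -mulr_sumr exchange_big /= expr2 -mulrA ler_wpM2l // mulr_sumr.
  by apply: ler_sum => y _; rewrite -mulr_suml ler_wpM2r ?sqr_ge0.
have Mf : \sum_x (\sum_y (1 - N x y) * (1 * f y)) ^+ 2 <= (n ^+ 2 - c) * sqnorm f.
  have -> : n ^+ 2 - c = \sum_x \sum_y (1 - N x y).
    under eq_bigr do rewrite sumrB Nsum sumr_const.
    by rewrite sumrB sumr_const -mulr_natr expr2.
  rewrite mulr_suml; apply: ler_sum => x _.
  apply: le_trans (weighted_cauchy_schwarz _ _ (M0 x)) _.
  under eq_bigr do rewrite expr1n mulr1.
  apply: ler_wpM2l; first by apply: sumr_ge0.
  by apply: ler_sum => y _; rewrite ler_piMl ?sqr_ge0.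
apply: (@le_trans _ _ (2 * \sum_x (\sum_y B x y * (1 * f y)) ^+ 2 +
  2 * \sum_x (\sum_y (1 - N x y) * (1 * f y)) ^+ 2)); last by lra.
rewrite !mulr_sumr -big_split; apply: ler_sum => x _; rewrite AB /=.
set u := \sum_y _; set v := \sum_y _.
by rewrite -subr_ge0 (_ : _ - _ = (u + v) ^+ 2) ?sqr_ge0 //; ring.
Qed.

(** Cauchy-Schwarz bounds the degree sum by the norm of [A 1], and log-convexity passes to [A^k 1].
    In its squared norm one factor of each row sum is bounded by [n + b]; the other sums to at most
    [c + n * b]. *)
Lemma sum_ends_ge : 0 <= b -> (0 < k)%N ->
  (\sum_x #|nbrs e x|)%:R ^+ k.*2 <= n ^+ k.*2.-1 * ((n + b) * (c + n * b)).
Proof.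
move=> b0; case: k walks_ends @c => // k' wE c' _.
pose one : V -> R := fun=> 1.
have n0 : 0 <= n by rewrite ler0n.
have deg x : adjacency one x = #|nbrs e x|%:R.
  rewrite /adjacency /one -sum1_card natr_sum.
  by apply: eq_bigl => y; rewrite inE.
have s1 : sqnorm one = n.
  rewrite /sqnorm /one; under eq_bigr do rewrite expr1n.
  by rewrite sumr_const.
have cs : (\sum_x #|nbrs e x|)%:R ^+ 2 <= n * sqnorm (adjacency one).
  rewrite -s1; apply: le_trans (cauchy_schwarz _ _).
  by rewrite natr_sum le_eqVlt (eq_bigr (fun x => one x * adjacency one x)) ?eqxx
     // => x _; rewrite mul1r deg.
have wk : sqnorm (iter k'.+1 adjacency one) <= (n + b) * (c' + n * b).
  have -> : n * b = \sum_(x : V) b by rewrite sumr_const -mulr_natl.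
  rewrite /c' -big_split mulr_sumr; apply: ler_sum => x _ /=.
  rewrite -/(iter k'.+1 adjacency one x) iter_adjacency_walks.
  under eq_bigr do rewrite mulr1.
  rewrite -natr_sum expr2; apply: ler_pM; rewrite ?ler0n //.
  by apply: le_trans (wE x) _; rewrite lerD2r ler_nat max_card.
have -> : k'.+1.*2.-1 = (k'.+1 + k')%N by rewrite -addnn addnS addSn.
rewrite -mul2n exprM.
apply: le_trans (lerXn2r k'.+1 _ _ cs) _; rewrite ?nnegrE ?sqr_ge0 //.
  by rewrite mulr_ge0 ?sqnorm_ge0.
rewrite exprMn exprD -mulrA ler_wpM2l ?exprn_ge0 //.
apply: le_trans (sqnorm_iter_adjacency _ _) _.
by rewrite s1 ler_wpM2l ?exprn_ge0.
Qed.

End WalkCount.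

(** Indicators split into mean and deviation. The graph need not be regular, so the deviation of [T]
    against the constant vector gives a second error term, whence the factor 2. *)
Lemma expander_mixing (rho : R) (S T : {set V}) : (0 < #|V|)%N -> 0 <= rho ->
  (forall f, \sum_x f x = 0 -> sqnorm (adjacency f) <= rho ^+ 2 * sqnorm f) ->
  `|(arcs e S T)%:R -
    (arcs e setT setT)%:R / #|V|%:R ^+ 2 * #|S|%:R * #|T|%:R| <= 2 * rho * #|V|%:R.
Proof.
move=> V0 rho0 contr; set n : R := #|V|%:R.
have n0 : 0 < n by rewrite ltr0n.
pose ind (A : {set V}) x : R := (x \in A)%:R.
pose dev (A : {set V}) x : R := ind A x - #|A|%:R / n.
have ind_sum A : \sum_x ind A x = #|A|%:R by rewrite card_sum_mem natr_sum.
have indT x : ind setT x = 1 by rewrite /ind inE.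
have dev_sum A : \sum_x dev A x = 0.
  rewrite sumrB ind_sum sumr_const -[(_ / _) *+ _]mulr_natr divfK ?subrr //.
  by rewrite gt_eqF.
have ind_sq A : sqnorm (ind A) = #|A|%:R.
  by rewrite -ind_sum; apply: eq_bigr => x _; rewrite /ind expr2 -natrM mulnb andbb.
have card_le (A : {set V}) : #|A|%:R <= n by rewrite ler_nat max_card.
have dev_sq A : sqnorm (dev A) <= n.
  apply: le_trans (card_le A); rewrite -ind_sq.
  have -> : sqnorm (dev A) = sqnorm (ind A) - #|A|%:R ^+ 2 / n.
    transitivity (sqnorm (ind A) - 2 * (#|A|%:R / n) * \sum_x ind A x +
      \sum_(x : V) (#|A|%:R / n) ^+ 2).
      rewrite mulr_sumr -sumrB -big_split; apply: eq_bigr => x _ /=.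
      by rewrite /dev; ring.
    rewrite ind_sum sumr_const -[(_ ^+ 2) *+ _]mulr_natr -/n.
    by field; rewrite gt_eqF.
  by rewrite gerBl divr_ge0 ?sqr_ge0 ?ltW.
have bound f g : \sum_x f x = 0 -> sqnorm f <= n -> sqnorm g <= n ->
    `|\sum_x adjacency f x * g x| <= rho * n.
  move=> f0 fn gn; rewrite -(ler_pXn2r (n := 2)) ?nnegrE ?mulr_ge0 ?(ltW n0) //.
  rewrite real_normK ?num_real //; apply: le_trans (cauchy_schwarz _ _) _.
  rewrite exprMn [n ^+ 2]expr2 mulrA; apply: ler_pM; rewrite ?sqnorm_ge0 //.
  by apply: le_trans (contr f f0) _; rewrite ler_wpM2l ?sqr_ge0.
have arcsE A A' : (arcs e A A')%:R = \sum_x ind A x * adjacency (ind A') x.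
  rewrite /arcs natr_sum big_mkcond; apply: eq_bigr => x _.
  rewrite /ind; case: (x \in A); rewrite ?mul0r ?mul1r // natr_sum /adjacency.
  by rewrite big_mkcond [RHS]big_mkcond; apply: eq_bigr => y _; do 2!case: (_ y).
have -> : (arcs e S T)%:R - (arcs e setT setT)%:R / n ^+ 2 * #|S|%:R * #|T|%:R =
  \sum_x adjacency (dev S) x * ind T x +
  #|S|%:R / n * \sum_x adjacency (dev T) x * ind setT x.
  rewrite -!adjacency_selfadjoint.
  have adj_dev A x : adjacency (dev A) x =
      adjacency (ind A) x - #|A|%:R / n * adjacency (ind setT) x.
    rewrite /adjacency mulr_sumr -sumrB; apply: eq_bigr => y _.
    by rewrite /dev indT mulr1.
  have -> : \sum_x dev S x * adjacency (ind T) x =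
      (arcs e S T)%:R - #|S|%:R / n * (arcs e setT T)%:R.
    rewrite !arcsE mulr_sumr -sumrB; apply: eq_bigr => x _.
    by rewrite /dev indT mul1r mulrBl.
  have -> : \sum_x dev T x * adjacency (ind setT) x =
      (arcs e setT T)%:R - #|T|%:R / n * (arcs e setT setT)%:R.
    rewrite adjacency_selfadjoint !arcsE mulr_sumr -sumrB.
    apply: eq_bigr => x _.
    by rewrite adj_dev indT mulr1 !mul1r.
  by field; rewrite gt_eqF.
apply: le_trans (ler_normD _ _) _.
have -> : 2 * rho * n = rho * n + rho * n by ring.
apply: lerD.
  by apply: bound; rewrite ?ind_sq.
rewrite normrM ger0_norm ?divr_ge0 ?ler0n // -[leRHS]mul1r.
apply: ler_pM => //; first by rewrite divr_ge0.
  by rewrite ler_pdivrMr // mul1r.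
by apply: bound; rewrite ?ind_sq.
Qed.

End AdjacencyOperator.

(** The condition on [rho] is the bound of [sqnorm_iter_adjacency_sum0] with [c] replaced by its
    lower bound from [sum_ends_ge]; log-convexity then extracts the [k]-th root. The value of [b] is
    that of [sum_walks_ends] divided by [D]. *)
Lemma unique_paths_mixing (R : realFieldType) (V : finType) (e : rel V)
    (k D : nat) (rho : R) (S T : {set V}) (n := #|V|%:R : R)
    (b := k%:R ^+ 2 * D%:R ^+ k.-1 : R) (m := (arcs e setT setT)%:R : R) :
  symmetric e -> path_unique e k -> (0 < k)%N -> (0 < #|V|)%N -> (0 < D)%N ->
  (forall x, (#|nbrs e x| <= D)%N) -> 0 <= rho ->
  2 * (n ^+ 2 - m ^+ k.*2 / (n ^+ k.*2.-1 * (n + b)) + n * b + b ^+ 2) <=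
    rho ^+ k.*2 ->
  `|(arcs e S T)%:R - m / n ^+ 2 * #|S|%:R * #|T|%:R| <= 2 * rho * n.
Proof.
move=> e_sym e_uniq k0 V0 D0 degD rho0 rho_large.
have n0 : 0 < n by rewrite ltr0n.
have b0 : 0 <= b by rewrite mulr_ge0 ?exprn_ge0 ?ler0n.
have walks_ends x : (\sum_y walks e k x y)%:R <= #|ends e k x|%:R + b.
  rewrite -(ler_pM2r (_ : 0 < D%:R)) ?ltr0n // mulrDl /b -mulrA -exprSr.
  rewrite prednK // -!natrX -!natrM -natrD ler_nat.
  by apply: (sum_walks_ends e_uniq).
apply: expander_mixing => // f f0.
have [k' kE] : exists k', k = k'.+1 by exists k.-1; rewrite prednK.
rewrite -(ler_pXn2r (n := k)) ?nnegrE ?sqnorm_ge0 ?mulr_ge0 ?sqnorm_ge0 ?sqr_ge0 //.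
rewrite {1}kE; apply: le_trans (sqnorm_iter_adjacency e_sym f k') _.
rewrite -kE exprMn -exprM mul2n {3}kE [X in _ <= _ * X]exprSr mulrCA.
rewrite ler_wpM2l ?exprn_ge0 ?sqnorm_ge0 //.
apply: le_trans (sqnorm_iter_adjacency_sum0 e_sym walks_ends f0) _.
rewrite ler_wpM2r ?sqnorm_ge0 //; apply: le_trans rho_large.
rewrite ler_pM2l ?ltr0n // lerD2r -addrA lerD2l.
rewrite lerNl opprD opprK lerBlDr.
rewrite ler_pdivrMr ?mulr_gt0 ?exprn_gt0 ?ltr_pwDl //.
have := sum_ends_ge e_sym walks_ends b0 k0.
suff -> : (\sum_x #|nbrs e x|)%N = arcs e setT setT.
  by rewrite mulrA [leRHS]mulrC.
rewrite /arcs; apply: eq_big => [x|x _]; first by rewrite inE.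
rewrite card_sum_mem; apply: eq_big => [y|y _]; by rewrite inE.
Qed.

(** * Asymptotics *)

(** Arcs lost between [S] and [T] are among all arcs lost; the additive form avoids truncated
    subtraction. *)
Lemma arcs_subrel (V : finType) (r' r : rel V) (S T : {set V}) : subrel r' r ->
  (arcs r' S T <= arcs r S T)%N /\
  (arcs r S T + arcs r' setT setT <= arcs r' S T + arcs r setT setT)%N.
Proof.
move=> sub.
have arcsE e A A' : arcs e A A' =
    (\sum_x \sum_(y : V) [&& x \in A, y \in A' & e x y])%N.
  rewrite /arcs big_mkcond; apply: eq_bigr => x _.
  case: (x \in A) => /=; last by rewrite big1.
  by rewrite big_mkcond; apply: eq_bigr => y _; case: (y \in A').
have le_r x y : (r' x y <= r x y)%N.
  by have := @sub x y; case: (r' x y) => // ->.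
rewrite !arcsE -!big_split; split; apply: leq_sum => x _.
  by apply: leq_sum => y _; case: (x \in S); case: (y \in T); rewrite //= le_r.
rewrite -!big_split; apply: leq_sum => y _; rewrite !inE /=.
by have := le_r x y; case: (x \in S); case: (y \in T); rewrite //= addnC.
Qed.

Lemma edges_between_arcs (G : sgraph) (S T : {set G}) :
  edges_between S T = arcs (@adj G) S T.
Proof.
rewrite /edges_between -sum1_card /arcs pair_big_dep big_mkcond.
rewrite [RHS]big_mkcond; apply: eq_bigr => -[x y] _ /=; rewrite inE /=.
by case: (x \in S); case: (y \in T); case: (adj x y).
Qed.

Lemma avg_degree_arcs (R : realType) (G : sgraph) :
  avg_degree R G = (arcs (@adj G) setT setT)%:R / #|G|%:R.
Proof.
rewrite /avg_degree; congr (_%:R / _); rewrite /arcs.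
apply: eq_big => [x|x _]; first by rewrite inE.
by rewrite /degree card_sum_mem; apply: eq_big => [y|y _]; rewrite inE.
Qed.

Lemma induced_path_unique (G : sgraph) (k : nat) (U : {set G}) :
  family_free (fun H => even_cycles k H \/ short_cycles k H) G ->
  path_unique (induced_rel (@adj G) U) k.
Proof.
move=> G_free x p q pk pq pp qp up uq lpq.
have sub : subrel (induced_rel (@adj G) U) (@adj G) by move=> ? ? /and3P[].
apply: (simple_paths_eq G_free _ (sub_path sub pp) (sub_path sub qp)) => //.
by rewrite pq addnn odd_double leq_double pk orbT.
Qed.

Lemma bernoulli_subr (R : realDomainType) (x : R) (j : nat) : 0 <= x <= 1 ->
  1 - j%:R * x <= (1 - x) ^+ j.
Proof.
case/andP=> x0 x1; elim: j => [|j IHj]; first by rewrite mul0r subr0.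
have x1' : 0 <= 1 - x by rewrite subr_ge0.
rewrite exprS; apply: le_trans (ler_wpM2l x1' IHj).
have j0 : (0 : R) <= j%:R by rewrite ler0n.
rewrite -natr1; nra.
Qed.

(** * Explicit error for a single graph *)

Section GraphMixing.
Variables (R : realType) (k : nat) (G : sgraph).
Hypothesis k_gt0 : (0 < k)%N.
Hypothesis G_free :
  family_free (fun H => even_cycles k H \/ short_cycles k H) G.
Variables (q eps eta : R).
Let n : R := #|G|%:R.
Let K : R := 1 + (2 / eps) ^+ k.-1.
Hypotheses (qk : q ^+ k = n) (q_ge1 : 1 <= q) (eps_gt0 : 0 < eps).
Hypothesis eps_le : 3 * eps <= 1.
Hypothesis eps_eta : eps <= eta.
Hypothesis eps_eta_pow : 18 * k%:R * eps <= eta ^+ k.*2.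
Hypothesis q_large1 : 2 * (k.+1)%:R <= eps * q.
Hypothesis q_large2 : k%:R ^+ 2 * K ^+ k.-1 <= eps * q.
Hypothesis d_large : (1 - eps) * q <= avg_degree R G.

(** As [c - k] is at least [eps * q / 2], [degree_bound] and [n = q ^+ k] bound the degree minus 1
    by [(2 / eps) ^+ k.-1 * q]. *)
Lemma max_degree_le (e : rel G) (x : G) : symmetric e -> path_unique e k ->
  (forall z y, e z y -> (Num.truncn (eps * q) <= #|nbrs e z|)%N) ->
  #|nbrs e x|%:R <= K * q.
Proof.
set c := Num.truncn _ => e_sym e_uniq minc.
have q0 : 0 < q by apply: lt_le_trans q_ge1.
have eq0 : 0 <= eps * q by rewrite mulr_ge0 // ltW.
have /andP[_ c_gt] : c%:R <= eps * q < c.+1%:R by rewrite truncn_itv.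
have kR : (k.+1)%:R = k%:R + 1 :> R by rewrite natr1.
have cR : (c.+1)%:R = c%:R + 1 :> R by rewrite natr1.
move: (q_large1) c_gt (ler0n R k); rewrite kR cR => q_large c_gt kR0.
have kc : (k <= c)%N by rewrite -(ler_nat R); lra.
(* Here [c] exceeds [eps * q - 1], and [k + 1] is at most half of [eps * q]. *)
have half : eps * q / 2 <= (c - k)%:R by rewrite natrB //; lra.
have := degree_bound e_sym e_uniq x k_gt0 minc.
rewrite -(ler_nat R) natrM natrX -/n -qk => deg.
have : #|nbrs e x|.-1%:R * (eps * q / 2) ^+ k.-1 <= q ^+ k.
  apply: le_trans deg; rewrite ler_wpM2l ?ler0n // lerXn2r ?nnegrE ?ler0n //.
  by rewrite divr_ge0.
have h0 : 0 < (eps * q / 2) ^+ k.-1 by rewrite exprn_gt0 // divr_gt0 ?mulr_gt0.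
rewrite -ler_pdivlMr // => {}deg.
have -> : K * q = q + q ^+ k / (eps * q / 2) ^+ k.-1.
  rewrite /K -[in q ^+ k](prednK k_gt0) exprS mulrDl mul1r; congr (_ + _).
  rewrite (_ : eps * q / 2 = q / (2 / eps)); last by field; rewrite gt_eqF.
  rewrite [(q / _) ^+ _]exprMn exprVn; field.
  by rewrite !expf_neq0 ?gt_eqF // ?invr_gt0 ?divr_gt0.
have : #|nbrs e x|%:R <= 1 + #|nbrs e x|.-1%:R :> R.
  by rewrite -[X in X + _]/(1%:R) -natrD ler_nat add1n leqSpred.
by move/le_trans; apply; apply: lerD.
Qed.

(** Half of the error is the mixing error of the dense subgraph, half pays for the deleted arcs. *)
Lemma graph_mixing (S T : {set G}) :
  `|(edges_between S T)%:R - avg_degree R G / n * #|S|%:R * #|T|%:R| <=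
    4 * eta * (n * q).
Proof.
have q0 : 0 < q by apply: lt_le_trans q_ge1.
have n0 : 0 < n by rewrite -qk exprn_gt0.
have eq0 : 0 <= eps * q by rewrite mulr_ge0 // ltW.
have k1 : (1 : R) <= k%:R by rewrite ler1n.
pose c := Num.truncn (eps * q).
have /andP[c_le _] : c%:R <= eps * q < c.+1%:R by rewrite truncn_itv.
have [U [minc denseU]] := dense_subgraph (@adj_sym G) (@adj_irr G) c.
set e := induced_rel (@adj G) U in minc denseU.
have e_sym : symmetric e.
  by move=> x y; rewrite /e /induced_rel adj_sym andbCA.
have e_uniq : path_unique e k by apply: induced_path_unique.
pose m : R := (arcs e setT setT)%:R.
pose mG : R := (arcs (@adj G) setT setT)%:R.
have mGm : mG <= m + 2 * eps * q * n.
  have : mG <= m + 2 * c%:R * n.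
    by rewrite -natrM -natrM -natrD ler_nat.
  move/le_trans; apply; rewrite lerD2l ler_pM2r //; lra.
have dE : avg_degree R G = mG / n by rewrite avg_degree_arcs.
have mGd : (1 - eps) * q * n <= mG by rewrite -ler_pdivlMr // -dE.
(* One [eps] comes from the average degree, two from the deleted arcs. *)
have m_ge : n * q * (1 - 3 * eps) <= m.
  move: mGm mGd; rewrite (_ : 2 * eps * q * n = 2 * (n * q * eps)); last by ring.
  rewrite (_ : (1 - eps) * q * n = n * q - n * q * eps); last by ring.
  rewrite (_ : n * q * (1 - 3 * eps) = n * q - 3 * (n * q * eps)); last by ring.
  lra.
have K1 : 1 <= K by rewrite lerDl exprn_ge0 // divr_ge0 ?ltW.
have Kq1 : 1 <= K * q by apply: mulr_ege1.
pose D := Num.truncn (K * q).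
have D_le : D%:R <= K * q by rewrite truncn_le; apply: le_trans Kq1.
have D0 : (0 < D)%N by rewrite truncn_gt0.
have degD x : (#|nbrs e x| <= D)%N.
  by rewrite truncn_ge_nat ?max_degree_le //; apply: le_trans Kq1.
pose b : R := k%:R ^+ 2 * D%:R ^+ k.-1.
have b0 : 0 <= b by rewrite mulr_ge0 ?exprn_ge0 ?ler0n.
have b_le : b <= eps * n.
  rewrite -(ler_pM2r q0) -qk -[in leRHS](prednK k_gt0) exprSr.
  apply: (@le_trans _ _ (k%:R ^+ 2 * (K * q) ^+ k.-1 * q)).
    rewrite ler_pM2r // /b ler_wpM2l ?sqr_ge0 // lerXn2r ?nnegrE ?ler0n //.
    exact: le_trans Kq1.
  rewrite exprMn.
  have := ler_wpM2r (_ : 0 <= q ^+ k.-1 * q) q_large2.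
  rewrite mulr_ge0 ?exprn_ge0 ?(ltW q0) // => /(_ isT).
  by rewrite !mulrA [_ * q * _]mulrAC.
have main : 2 * (n ^+ 2 - m ^+ k.*2 / (n ^+ k.*2.-1 * (n + b)) + n * b + b ^+ 2) <=
    (eta * q) ^+ k.*2.
  have eps1 : 0 <= 3 * eps <= 1 by rewrite eps_le mulr_ge0 ?ltW.
  (* Bernoulli on [(1 - 3 * eps) ^+ k.*2] costs [6 * k * eps]; replacing [n + b] by [(1 + eps) * n]
     costs one more [eps]. *)
  have quot : n ^+ 2 * (1 - 6 * k%:R * eps - eps) <=
      m ^+ k.*2 / (n ^+ k.*2.-1 * (n + b)).
    rewrite ler_pdivlMr ?mulr_gt0 ?exprn_gt0 ?ltr_pwDl //.
    apply: (@le_trans _ _ ((n * q * (1 - 3 * eps)) ^+ k.*2)); last first.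
      rewrite lerXn2r ?nnegrE ?ler0n // !mulr_ge0 ?(ltW n0) ?(ltW q0) //.
      by rewrite subr_ge0.
    have nq : (n * q) ^+ k.*2 = n ^+ k.*2.-1 * n * n ^+ 2.
      rewrite exprMn -exprSr prednK ?double_gt0 //.
      by rewrite -[in q ^+ _]mul2n mulnC exprM qk.
    rewrite exprMn nq.
    have bern := bernoulli_subr k.*2 eps1.
    rewrite -mul2n natrM in bern.
    rewrite (_ : n ^+ 2 * _ * _ = n ^+ k.*2.-1 * n ^+ 2 *
      ((1 - 6 * k%:R * eps - eps) * (n + b))); last by ring.
    rewrite (_ : _ * n * _ * _ = n ^+ k.*2.-1 * n ^+ 2 *
      ((1 - 3 * eps) ^+ k.*2 * n)); last by ring.
    rewrite ler_pM2l ?mulr_gt0 ?exprn_gt0 //.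
    rewrite -mul2n.
    set p := (1 - 3 * eps) ^+ _ in bern *.
    have p0 : 0 <= p by rewrite exprn_ge0 // subr_ge0.
    have ke0 : 0 <= k%:R * eps by rewrite mulr_ge0 ?ler0n ?ltW.
    (* Enlarging [n + b] preserves the inequality only when its factor is nonnegative. *)
    have [neg|pos] := lerP (1 - 6 * k%:R * eps - eps) 0.
      apply: (@le_trans _ _ 0); last exact: mulr_ge0 p0 (ltW n0).
      by rewrite mulr_le0_ge0 // addr_ge0 // (ltW n0).
    apply: (@le_trans _ _ ((1 - 6 * k%:R * eps - eps) * ((1 + eps) * n))).
      by rewrite ler_pM2l //; lra.
    rewrite mulrA ler_pM2r //; nra.
  have en0 : 0 <= eps * n by rewrite mulr_ge0 // ltW.
  have b2 : b ^+ 2 <= (eps * n) ^+ 2 by rewrite lerXn2r ?nnegrE.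
  have nb : n * b <= n * (eps * n) by rewrite ler_pM2l.
  (* The total is [12 * k + 4 + 2 * eps] times [eps * n ^+ 2], and [k >= 1], [eps <= 1]. *)
  apply: (@le_trans _ _ (n ^+ 2 * (18 * k%:R * eps))).
    have : 0 <= n ^+ 2 * (3 * (k%:R * eps) - 2 * eps - eps ^+ 2).
      rewrite mulr_ge0 ?sqr_ge0 //; nra.
    move: quot b2 nb.
    rewrite (_ : n ^+ 2 * (1 - 6 * k%:R * eps - eps) =
      n ^+ 2 - 6 * (n ^+ 2 * (k%:R * eps)) - n ^+ 2 * eps); last by ring.
    rewrite (_ : n ^+ 2 * (18 * k%:R * eps) = 18 * (n ^+ 2 * (k%:R * eps))); last by ring.
    rewrite (_ : n ^+ 2 * (3 * _ - _ - _) = 3 * (n ^+ 2 * (k%:R * eps))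
       - 2 * (n ^+ 2 * eps) - (eps * n) ^+ 2); last by ring.
    rewrite (_ : n * (eps * n) = n ^+ 2 * eps); last by ring.
    lra.
  rewrite exprMn mulrC -[in q ^+ _]mul2n mulnC exprM qk.
  by rewrite ler_wpM2r ?sqr_ge0.
have eta0 : 0 <= eta by apply: le_trans eps_eta; apply: ltW.
have V0 : (0 < #|G|)%N by rewrite -(ltr_nat R).
have mix := unique_paths_mixing S T e_sym e_uniq k_gt0 V0 D0 degD
  (mulr_ge0 eta0 (ltW q0)) main.
have sub : subrel e (@adj G) by move=> x y /and3P[].
have [le1 le2] := arcs_subrel S T sub.
have [leT _] := arcs_subrel setT setT sub.
rewrite edges_between_arcs dE.
move: le1 le2 leT; rewrite -!(ler_nat R) !natrD -/m -/mG => le1 le2 leT.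
rewrite -/n -/m in mix.
set st := #|S|%:R * #|T|%:R : R.
have st0 : 0 <= st by rewrite mulr_ge0 ?ler0n.
have stn : st <= n ^+ 2.
  by rewrite expr2; apply: ler_pM; rewrite ?ler0n // ler_nat max_card.
(* Deletion lowers both the arc count and the density term by at most [mG - m]; these changes have
   opposite signs, so the loss is paid once. *)
have loss : (mG - m) / n ^+ 2 * st <= mG - m.
  rewrite -mulrA ler_piMr ?subr_ge0 // mulrC ler_pdivrMr ?exprn_gt0 //.
  by rewrite mul1r.
have loss0 : 0 <= (mG - m) / n ^+ 2 * st.
  by rewrite mulr_ge0 // divr_ge0 ?subr_ge0 ?sqr_ge0.
rewrite (_ : mG / n / n * #|S|%:R * #|T|%:R =
    m / n ^+ 2 * #|S|%:R * #|T|%:R + (mG - m) / n ^+ 2 * st); last first.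
  by rewrite /st; field; rewrite gt_eqF.
have eps_small : 2 * eps * q * n <= 2 * (eta * q) * n.
  by rewrite ler_pM2r // -mulrA ler_pM2l // ler_pM2r.
rewrite (_ : 4 * eta * (n * q) = 2 * (eta * q) * n + 2 * (eta * q) * n); last by ring.
move: mix; rewrite !ler_norml => /andP[mix1 mix2].
by apply/andP; split; lra.
Qed.

End GraphMixing.

Local Open Scope classical_set_scope.
Local Open Scope ring_scope.

Theorem theorem5p8 (R : realType) (k : nat) (k_ge2 : (2 <= k)%N)
    (G : nat -> sgraph)
    (G_free : forall i, family_free (fun H => even_cycles k H \/ short_cycles k H) (G i))
    (n_oo : #|G i| @[i --> \oo] --> \oo)
    (d_sim : avg_degree R (G i) / #|G i|%:R `^ k%:R^-1 @[i --> \oo] --> (1 : R)) :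
  exists2 err : nat -> R,
    err =o_\oo (fun i => #|G i|%:R `^ (1 + k%:R^-1) : R) &
    forall i (S T : {set G i}),
      `|(edges_between S T)%:R
        - avg_degree R (G i) / #|G i|%:R * #|S|%:R * #|T|%:R| <= err i.
Proof.
have k0 : (0 < k)%N by apply: leq_trans k_ge2.
have kR0 : 0 < k%:R :> R by rewrite ltr0n.
pose F i (p : {set G i} * {set G i}) : R := `|(edges_between p.1 p.2)%:R
        - avg_degree R (G i) / #|G i|%:R * #|p.1|%:R * #|p.2|%:R|.
(* The maximum over all pairs makes the error uniform in [S] and [T]. *)
exists (fun i => \big[Num.max/0]_p F i p) => [|i S T]; last first.
  by have := @le_bigmax _ R _ 0 (F i) (S, T).
apply/eqoP => dlt dlt0.
(* [graph_mixing] has error [4 * eta]; the terms of [eps] below provide [eps_eta], [eps_le] and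
   [eps_pow]. *)
pose eta : R := dlt / 4.
have eta0 : 0 < eta by rewrite divr_gt0.
pose eps : R := Num.min eta (Num.min (1 / 3) (eta ^+ k.*2 / (18 * k%:R))).
have eps0 : 0 < eps.
  by rewrite !lt_min eta0 !divr_gt0 ?exprn_gt0 ?mulr_gt0.
have eps_eta : eps <= eta by rewrite ge_min lexx.
have eps_le : 3 * eps <= 1.
  by rewrite mulrC -ler_pdivlMr // !ge_min lexx /= orbT.
have eps_pow : 18 * k%:R * eps <= eta ^+ k.*2.
  by rewrite mulrC -ler_pdivlMr ?mulr_gt0 // !ge_min lexx !orbT.
pose K : R := 1 + (2 / eps) ^+ k.-1.
(* The three terms are the lower bounds on [q] required by [graph_mixing]. *)
pose Q : R := Num.max 1 (Num.max (2 * (k.+1)%:R / eps) (k%:R ^+ 2 * K ^+ k.-1 / eps)).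
have Q0 : 0 <= Q by rewrite le_max ler01.
have d_near : \forall i \near \oo,
    `|1 - avg_degree R (G i) / #|G i|%:R `^ k%:R^-1| <= eps.
  by move/cvgrPdist_le: d_sim; apply.
have n_near : \forall i \near \oo, ((Num.truncn (Q ^+ k)).+1 <= #|G i|)%N.
  exact: (cvgnyPge _).1 n_oo _.
near=> i.
have d_i : `|1 - avg_degree R (G i) / #|G i|%:R `^ k%:R^-1| <= eps by near: i.
have n_i : ((Num.truncn (Q ^+ k)).+1 <= #|G i|)%N by near: i.
set n : R := #|G i|%:R; pose q : R := n `^ k%:R^-1.
have q0 : 0 <= q by apply: powR_ge0.
have qk : q ^+ k = n.
  by rewrite -powR_mulrn // -powRrM mulVf ?gt_eqF // powRr1 // ler0n.
have qQ : Q <= q.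
  rewrite -(ler_pXn2r k0) ?nnegrE // qk.
  by apply: le_trans (ltW (truncnS_gt _)) _; rewrite ler_nat.
move: (qQ); rewrite !ge_max => /and3P[q1].
rewrite !ler_pdivrMr // ![q * eps]mulrC => q2 q3.
have q_gt0 : 0 < q by apply: lt_le_trans q1.
have d_large : (1 - eps) * q <= avg_degree R (G i).
  rewrite -ler_pdivlMr // lerBlDl -lerBlDr.
  exact: le_trans (ler_norm _) d_i.
have n0 : 0 < n by rewrite -qk exprn_gt0.
have -> : n `^ (1 + k%:R^-1) = n * q.
  by rewrite powRD ?powRr1 ?ltW // gt_eqF ?implybT.
rewrite [`|n * q|]ger0_norm ?mulr_ge0 ?(ltW n0) //.
rewrite ger0_norm; last by elim/big_rec: _ => // p x _; rewrite le_max orbC => ->.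
apply/bigmax_leP; split=> [|[S T] _]; first by rewrite !mulr_ge0 ?ltW.
have := graph_mixing k0 (@G_free i) qk q1 eps0 eps_le eps_eta eps_pow q2 q3 d_large S T.
by rewrite /F (_ : 4 * eta = dlt) // /eta mulrC divfK.
Unshelve. all: by end_near.
Qed.
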